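(* Suppose that $D$ is a discrete space of cardinality at least two, $X$ is an analytic Hausdorff space, and $H$ is a box-open $D$-dimensional dihypergraph on $X$. Then exactly one of the following holds: (1) there is an $\aleph_0$-coloring of $H$; (2) there is a continuous homomorphism from $\mathbb{H}_{D^{\mathbb{N}}}$ to $H$.
   Context: Base theory: $\mathsf{ZF}+\mathsf{DC}$. A topological space is analytic if it is a continuous image of a closed subset of $\mathbb{N}^{\mathbb{N}}$. A $D$-ary relation on $X$ is a subset of $X^D$. A homomorphism from a $D$-ary relation $R$ on $X$ to a $D$-ary relation $S$ on $Y$ is a map $\pi\colon X\to Y$ such that $(\pi(x_d))_{d\in D}\in S$ for all $(x_d)_{d\in D}\in R$. A $D$-dimensional dihypergraph on $X$ is a $D$-ary relation on $X$ containing no constant sequence. It is box-open if it is open in the box topology on $X^D$, i.e., the topology generated by the sets $\prod_{d\in D}U_d$ with every $U_d\subseteq X$ open. The complete $D$-dimensional dihypergraph on a set is the set of all non-constant $D$-sequences of its elements; an $\aleph_0$-coloring of $H$ is a homomorphism from $H$ to the complete $D$-dimensional dihypergraph on a set of cardinality $\aleph_0$ (i.e., a map that is non-constant along every element of $H$). $D^{\mathbb{N}}$ carries the product topology with $D$ discrete; $D^{<\mathbb{N}}$ is the set of finite sequences of elements of $D$; for $t\in D^{<\mathbb{N}}$, $\mathcal{N}_t=\{b\in D^{\mathbb{N}} : t\sqsubseteq b\}$, where $\sqsubseteq$ denotes extension; $t\cdot(d)$ is $t$ followed by the single entry $d$. $\mathbb{H}_{D^{\mathbb{N}}}=\bigcup_{t\in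 D^{<\mathbb{N}}}\prod_{d\in D}\mathcal{N}_{t\cdot(d)}$, a $D$-dimensional dihypergraph on $D^{\mathbb{N}}$. *)

(* Defs.v *)
From HB Require Import structures.
From mathcomp Require Import all_boot all_classical all_reals.
From mathcomp Require Import topology.

Set Implicit Arguments.
Unset Strict Implicit.
Unset Printing Implicit Defensive.

Local Open Scope classical_set_scope.

Notation baire_space := (prod_topology (fun _ : nat => nat : topologicalType)).

Notation sequence_space D :=
  (prod_topology (fun _ : nat => D : topologicalType)).

(* The map is defined only on the closed set [C], carried as a subtype with the
   induced topology, so that the empty space is analytic. *)
Definition analytic (X : topologicalType) : Prop :=
  exists2 C : set baire_space, closed C &
  exists2 f : C -> X, continuous f & range f = [set: X].

Definition homomorphism (D X Y : Type) (R : set (D -> X)) (S : set (D -> Y))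
  (pi : X -> Y) : Prop := forall x : D -> X, R x -> S (pi \o x).

Definition constant_seq (D X : Type) : set (D -> X) :=
  [set x | exists a, forall d, x d = a].

Definition dihypergraph (D X : Type) (H : set (D -> X)) : Prop :=
  forall x, H x -> ~ constant_seq x.

Definition complete_dihypergraph (D Y : Type) : set (D -> Y) :=
  [set y | ~ constant_seq y].

Definition has_aleph0_coloring (D X : Type) (H : set (D -> X)) : Prop :=
  exists2 Y : Type, ([set: Y] #= [set: nat])%card &
  exists c : X -> Y, homomorphism H (@complete_dihypergraph D Y) c.

Definition open_box (D : Type) (X : topologicalType) : set (set (D -> X)) :=
  [set B | exists2 U : D -> set X, forall d, open (U d) &
           B = [set x | forall d, U d (x d)]].

(* An alias of [D -> X], which keeps the box topology apart from the product
   topology. *)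
Definition box_topology (D : Type) (X : topologicalType) : Type := D -> X.

Section box_topology.
Variables (D : Type) (X : topologicalType).

HB.instance Definition _ := Choice.copy (box_topology D X) (D -> X).

Let open_box_cover :
  \bigcup_(B in @open_box D X) (id B : set (box_topology D X)) = setT.
Proof.
apply/seteqP; split=> // x _; exists setT => //; exists (fun=> setT).
  by move=> d; exact: openT.
by apply/seteqP; split.
Qed.

Let open_box_join (A B : set (box_topology D X)) (x : box_topology D X) :
  open_box A -> open_box B -> A x -> B x ->
  exists C, [/\ open_box C, C x & C `<=` A `&` B].
Proof.
move=> [U oU ->] [V oV ->] Ux Vx.
exists [set y | forall d, (U d `&` V d) (y d)]; split.
- by exists (fun d => U d `&` V d) => // d; exact: openI.
- by move=> d; split; [exact: Ux | exact: Vx].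
- by move=> y UVy; split=> d; have [] := UVy d.
Qed.

HB.instance Definition _ :=
  isBaseTopological.Build (box_topology D X) open_box_cover open_box_join.

End box_topology.

Definition box_open (D : Type) (X : topologicalType) (R : set (D -> X)) : Prop :=
  open (R : set (box_topology D X)).

Definition cylinder (D : Type) (t : seq D) : set (nat -> D) :=
  [set b | mkseq b (size t) = t].

Definition H_seq (D : Type) : set (D -> nat -> D) :=
  \bigcup_(t in [set: seq D]) [set x | forall d, cylinder (rcons t d) (x d)].

(* Main.v *)
(* Call a subset of [X] small if [H] restricted to it is colorable with
   countably many colors; small sets form a sigma-ideal.  Let [f : C -> X] be a
   continuous surjection from a closed subset of the Baire space, and call a
   point of [C] rich if no basic neighborhood of it has a small image.  The
   non-rich points have small image in total.  If [X] is not small, then every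
   neighborhood of a rich point therefore contains rich points whose images form
   an element of [H], and by box-openness so do the images of all points close
   enough to them.  Iterating along [D^{<N}] gives a scheme of shrinking
   cylinders whose limit map, composed with [f], is the required homomorphism.
   Conversely, a countable coloring pulls back along a homomorphism to a coloring
   of [H_seq D]; each color [n] misses some child [t (d)] of each node [t], so
   some branch avoids every color. *)

Require Import Defs.
From HB Require Import structures.
From mathcomp Require Import all_boot all_classical all_reals.
From mathcomp Require Import topology.

Set Implicit Arguments.
Unset Strict Implicit.
Unset Printing Implicit Defensive.

Local Open Scope classical_set_scope.

(** * Neighborhoods in sequence spaces and in the box topology *)

Lemma cylinder_mkseqP (T : Type) (a b : nat -> T) (n : nat) :
  cylinder (mkseq b n) a <-> forall i, (i < n)%N -> a i = b i.
Proof.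
rewrite /cylinder /= size_mkseq; split=> [ab i ltin|ab].
  by rewrite -(nth_mkseq (a i) a ltin) ab nth_mkseq.
by apply/eq_in_map => i; rewrite mem_iota add0n => /andP[_ /ab].
Qed.

Lemma nbhs_sequenceP (T : discreteTopologicalType) (b : sequence_space T)
    (U : set (sequence_space T)) :
  nbhs b U <-> exists n, cylinder (mkseq b n) `<=` U.
Proof.
have nbF : Filter (nbhs b) := nbhs_filter b.
split; last first.
  move=> [n bU]; apply: filterS bU _.
  elim: n => [|n IHn]; first by apply: filterS filterT => a _.
  have bn : nbhs b [set a : sequence_space T | a n = b n].
    exact: (@proj_continuous _ (fun=> T : topologicalType) n b _
             (discrete_set1 (b n))).
  apply: filterS2 IHn bn => a /cylinder_mkseqP ab abn.
  by apply/cylinder_mkseqP => i; rewrite ltnS leq_eqVlt => /predU1P[->|/ab].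
pose F : set_system (sequence_space T) :=
  filter_from [set: nat] (fun n => cylinder (mkseq b n)).
have FF : Filter F.
  apply: filter_from_filter; first by exists 0%N.
  move=> m n _ _; exists (maxn m n) => // a /cylinder_mkseqP ab.
  by split; apply/cylinder_mkseqP => i lti; apply: ab; rewrite leq_max lti ?orbT.
(* The product topology is the supremum of the coordinate topologies, so convergence can be checked
   one coordinate at a time. *)
suff Fb : F --> b by move=> /Fb [n _ bU]; exists n.
apply/cvg_sup => i; apply/cvg_image.
  by rewrite eqEsubset; split=> // v _; exists (fun=> v).
move=> A /nbhs_singleton Abi; exists ((fun a => a i) @^-1` A).
  by exists i.+1 => // a /cylinder_mkseqP/(_ i (ltnSn i)) /= ->.
by apply: image_preimage; apply/seteqP; split=> // v _; exists (fun=> v).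
Qed.

Lemma nbhs_baire_subsetP (C : set baire_space) (c : C) (U : set C) :
  nbhs c U <->
  exists n, forall a : C, cylinder (mkseq (val c) n) (val a) -> U a.
Proof.
split=> [[_ [[V oV <-] Vc VU]]|[n cU]].
  have /nbhs_sequenceP [n cV] : nbhs (val c) V by exact: open_nbhs_nbhs.
  by exists n => a /cV; exact: VU.
apply: filterS cU _.
apply: (@initial_continuous _ baire_space (val : C -> baire_space) c).
by apply/nbhs_sequenceP; exists n.
Qed.

Lemma box_openP (D : Type) (X : topologicalType) (H : set (D -> X))
    (x : D -> X) :
  box_open H -> H x ->
  exists U : D -> set X, [/\ forall d, open (U d), forall d, U d (x d) &
    forall y, (forall d, U d (y d)) -> H y].
Proof.
move=> [B Bbox <-] [V BV Vx].
have [U oU VE] := Bbox _ BV; exists U; split=> //.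
  by move: Vx; rewrite VE.
by move=> y Uy; exists V => //; rewrite VE.
Qed.

(** * The sigma-ideal of small sets *)

Definition colorable_on {D X : Type} (H : set (D -> X)) (A : set X) : Prop :=
  exists c : X -> nat, forall x, H x -> (forall d, A (x d)) ->
    ~ constant_seq (c \o x).

Lemma colorable_on_subset {D X : Type} {H : set (D -> X)} {A B : set X} :
  A `<=` B -> colorable_on H B -> colorable_on H A.
Proof.
by move=> AB [c cB]; exists c => x Hx Ax; apply: cB => // d; exact: AB.
Qed.

(** A point is colored by the pair of a chosen index whose set contains it and its color there. A
    sequence of constant color then lies in a single set, where its color is constant. *)
Lemma colorable_on_bigcup {D X : Type} {H : set (D -> X)} (d0 : D)
    (T : countType) (A : T -> set X) :
  (forall t, colorable_on H (A t)) -> colorable_on H (\bigcup_t A t).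
Proof.
move=> /choice[c cA].
have /choice[k kP] : forall x, exists o : option T,
    (\bigcup_t A t) x -> if o is Some t then A t x else False.
  move=> x; have [[t _ Atx]|nAx] := pselect ((\bigcup_t A t) x).
    by exists (Some t).
  by exists None.
exists (fun x => pickle (omap (fun t => (t, c t x)) (k x))) => x Hx Ax [a xa].
have kx d : exists t, k (x d) = Some t /\ A t (x d).
  by have := kP _ (Ax d); case: (k (x d)) => // t; exists t.
have [t0 [kt0 _]] := kx d0.
have tc d : k (x d) = Some t0 /\ c t0 (x d) = c t0 (x d0).
  have [t [kt _]] := kx d.
  have /(pcan_inj pickleK) := etrans (xa d) (esym (xa d0)).
  by rewrite /= kt kt0 => -[-> ->].
apply: (cA t0 x Hx) => [d|]; last by exists (c t0 (x d0)) => d; exact: (tc d).2.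
by have [t [kt Atx]] := kx d; move: kt; rewrite (tc d).1 => -[->].
Qed.

Lemma not_colorable_on_edge {D X : Type} {H : set (D -> X)} {A : set X} :
  ~ colorable_on H A -> exists x, H x /\ forall d, A (x d).
Proof.
move=> ncA; apply: contrapT => nx; apply: ncA; exists (fun=> 0%N) => x Hx Ax.
by exfalso; apply: nx; exists x.
Qed.

Lemma aleph0_coloringP {D X : Type} {H : set (D -> X)} (d0 : D) :
  has_aleph0_coloring H <-> colorable_on H setT.
Proof.
split=> [[Y Ycard [c cH]]|[c cH]]; last first.
  by exists nat; [exact: card_eqxx|exists c => x Hx; exact: cH].
have /card_set_bijP[g /set_bij_inj ginj] := Ycard.
exists (g \o c) => x Hx _ [a ga]; apply: (cH x Hx); exists (c (x d0)) => d.
by apply: ginj; rewrite ?inE //; exact: etrans (ga d) (esym (ga d0)).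
Qed.

(** * Incompatibility of the two alternatives *)

Section dichotomy.
Variables (D : discreteTopologicalType) (X : topologicalType).
Variables (H : set (D -> X)) (d0 : D).

Lemma coloring_no_hom (pi : sequence_space D -> X) :
  colorable_on H setT -> ~ homomorphism (@H_seq D) H pi.
Proof.
move=> [c cH] piH.
have /choice[next nextP] : forall p : nat * seq D, exists d, forall b,
    cylinder (rcons p.2 d) b -> c (pi b) <> p.1.
  move=> [n t] /=; apply: contrapT => nd.
  (* Otherwise every child of [t] contains a branch of color [n], and these branches form an element
     of [H_seq] whose image is monochromatic. *)
  have /choice[x xP] : forall d, exists b,
      cylinder (rcons t d) b /\ c (pi b) = n.
    move=> d; apply: contrapT => nb; apply: nd; exists d => b tb cb.
    by apply: nb; exists b.
  apply: (cH (pi \o x)) => //.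
    by apply: piH; exists t => // d; exact: (xP d).1.
  by exists n => d; exact: (xP d).2.
pose t := fix t n := if n is m.+1 then rcons (t m) (next (m, t m)) else [::].
pose b n := next (n, t n).
have tb n : t n = mkseq b n by elim: n => // n IHn; rewrite mkseqS -IHn.
(* Stage [n] of [b] avoids color [n]; here [n] is the color of [pi b] itself. *)
apply: (nextP (c (pi b), t (c (pi b))) b) => //=.
rewrite -[next _]/(b (c (pi b))) tb -mkseqS.
exact/cylinder_mkseqP.
Qed.

(** * Rich points *)

Variables (C : set baire_space) (f : C -> X).

Let piece (s : seq nat) : set X :=
  [set f c | c in [set c : C | cylinder s (val c)]].
Let rich (c : C) := forall n, ~ colorable_on H (piece (mkseq (val c) n)).

Lemma not_colorable_rich (s : seq nat) : ~ colorable_on H (piece s) ->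
  ~ colorable_on H
      [set f c | c in [set c : C | cylinder s (val c) /\ rich c]].
Proof.
move=> ncs cr; apply: ncs.
(* Index [None] carries the images of rich points; the other indices range over the countably many
   basic pieces and give the empty set when [piece u] is not small. *)
pose A (o : option (seq nat)) := if o is Some u
  then [set x | colorable_on H (piece u) /\ piece u x]
  else [set f c | c in [set c : C | cylinder s (val c) /\ rich c]].
apply: (@colorable_on_subset _ _ _ _ (\bigcup_o A o)).
  move=> _ [c sc <-]; have [rc|] := pselect (rich c).
    by exists None => //; exists c.
  move=> /existsNP[n /contrapT cn]; exists (Some (mkseq (val c) n)) => //.
  by split=> //; exists c => //; exact/cylinder_mkseqP.
apply: (colorable_on_bigcup d0) => -[u|] //=.
have [cu|ncu] := pselect (colorable_on H (piece u)).
  by apply: colorable_on_subset cu => x [].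
by exists (fun=> 0%N) => x _ /(_ d0)[].
Qed.

Lemma rich_exists : range f = [set: X] -> ~ colorable_on H setT ->
  exists c, rich c.
Proof.
move=> fC ncH.
have /not_colorable_rich/not_colorable_on_edge[x [_ /(_ d0)[c [_ rc] _]]] :
    ~ colorable_on H (piece [::]); last by exists c.
apply: contra_not ncH; apply: colorable_on_subset => x _.
by have [c _ <-] : range f x; [rewrite fC|exists c].
Qed.

(** * The scheme of cylinders along finite sequences *)

Hypothesis (C_closed : closed C) (f_cont : continuous f).
Hypothesis H_open : box_open H.

(** Box-openness gives each coordinate of an edge its own neighborhood, so the length [(q d).2] may
    vary with [d] without any bound. *)
Lemma rich_split (c : C) (n : nat) : rich c ->
  exists q : D -> C * nat,
    [/\ forall d, rich (q d).1, forall d, (n < (q d).2)%N,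
        forall d, cylinder (mkseq (val c) n) (val (q d).1) &
        forall y : D -> C,
          (forall d, cylinder (mkseq (val (q d).1) (q d).2) (val (y d))) ->
          H (f \o y)].
Proof.
move=> /(_ n)/not_colorable_rich/not_colorable_on_edge[x [Hx xr]].
have [U [oU Ux UH]] := box_openP H_open Hx.
have /choice[q qP] : forall d, exists p : C * nat,
    [/\ rich p.1, (n < p.2)%N, cylinder (mkseq (val c) n) (val p.1) &
      forall a : C, cylinder (mkseq (val p.1) p.2) (val a) -> U d (f a)].
  move=> d; have [a [ca ra] fa] := xr d.
  have /f_cont/nbhs_baire_subsetP[m am] : nbhs (f a) (U d).
    by apply: open_nbhs_nbhs; split=> //; rewrite fa.
  (* [n.+1] makes the length strictly increase; [m] keeps the image inside [U d]. *)
  exists (a, maxn n.+1 m); split=> //=; first exact: leq_maxl.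
  move=> e /cylinder_mkseqP ea; apply: am; apply/cylinder_mkseqP => i im.
  by apply: ea; rewrite leq_max im orbT.
exists q; split; [by move=> d; case: (qP d)..|].
by move=> y yq; apply: UH => d /=; have [_ _ _] := qP d; apply.
Qed.

Lemma hom_of_not_colorable : range f = [set: X] -> ~ colorable_on H setT ->
  exists pi : sequence_space D -> X,
    continuous pi /\ homomorphism (@H_seq D) H pi.
Proof.
move=> fC /(rich_exists fC)[c0 rc0].
have /choice[next nextP] : forall p : C * nat, exists q : D -> C * nat,
  rich p.1 ->
    [/\ forall d, rich (q d).1, forall d, (p.2 < (q d).2)%N,
        forall d, cylinder (mkseq (val p.1) p.2) (val (q d).1) &
        forall y : D -> C,
          (forall d, cylinder (mkseq (val (q d).1) (q d).2) (val (y d))) ->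
          H (f \o y)].
  (* The value at a non-rich point is arbitrary, since all nodes of the scheme will be rich. *)
  move=> [c n]; have [rc|nrc] := pselect (rich c); last by exists (fun=> (c, n)).
  by have [q qP] := rich_split n rc; exists q.
pose node (t : seq D) := foldl next (c0, 0%N) t.
have nodeS t d : node (rcons t d) = next (node t) d by exact: foldl_rcons.
have node_rich t : rich (node t).1.
  by elim/last_ind: t => [//|t d IHt]; rewrite nodeS; have [] := nextP _ IHt.
have node_size t : (size t <= (node t).2)%N.
  elim/last_ind: t => [//|t d IHt]; rewrite nodeS size_rcons.
  by have [_ /(_ d) lt_n _ _] := nextP _ (node_rich t); exact: leq_ltn_trans lt_n.
pose c (b : nat -> D) k : nat -> nat := val (node (mkseq b k)).1.
pose n (b : nat -> D) k := (node (mkseq b k)).2.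
have n_ge b k : (k <= n b k)%N.
  by have := node_size (mkseq b k); rewrite size_mkseq.
have nS b k : (n b k <= n b k.+1)%N.
  rewrite /n mkseqS nodeS.
  by have [_ /(_ (b k)) /ltnW] := nextP _ (node_rich (mkseq b k)).
have cS b k i : (i < n b k)%N -> c b k.+1 i = c b k i.
  rewrite /c /n mkseqS nodeS.
  have [_ _ /(_ (b k)) + _] := nextP _ (node_rich (mkseq b k)).
  by move=> /cylinder_mkseqP; apply.
have c_stable b k j i : (i < n b k)%N -> c b (k + j)%N i = c b k i.
  move=> ik; suff [] : (i < n b (k + j))%N /\ c b (k + j)%N i = c b k i by [].
  elim: j => [|j [IHn IHc]]; first by rewrite addn0.
  by rewrite addnS cS //; split=> //; exact: leq_trans (nS _ _).
have /choice[l lP] : forall b, exists l : C,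
    forall k, cylinder (mkseq (c b k) (n b k)) (val l).
  (* Entry [i] no longer changes from stage [i.+1] on, because [n b i.+1] exceeds [i]; the limit is
     therefore read off diagonally. *)
  move=> b; pose l i := c b i.+1 i.
  have lc k i : (i < n b k)%N -> l i = c b k i.
    move=> ik; have [ki|/ltnW ik'] := leqP k i.+1.
      by rewrite /l -(subnKC ki) c_stable.
    by rewrite -(subnKC ik') c_stable //; exact: n_ge.
  have Cl : C l.
    (* The centers [c b k] lie in [C] and converge to [l]. *)
    apply: C_closed => U /nbhs_sequenceP[k lU].
    exists (c b k); split; first exact/set_mem/(valP (node (mkseq b k)).1).
    apply: lU; apply/cylinder_mkseqP => i ik; rewrite (lc k i) //.
    exact: leq_trans (n_ge b k).
  exists (SigSub (mem_set Cl)) => k; apply/cylinder_mkseqP => i.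
  exact: lc.
exists (f \o l); split=> [b U /f_cont/nbhs_baire_subsetP[k kU]|x [t _ tx]].
  (* Branches agreeing up to [k] share their node at stage [k], so their limits agree on the first
     [n b k] entries, and [n b k] is at least [k]. *)
  apply/nbhs_sequenceP; exists k => b' bb'; apply: kU.
  have kb : mkseq b' k = mkseq b k by move: bb'; rewrite /cylinder /= size_mkseq.
  apply/cylinder_mkseqP => i ik; have ikn := leq_trans ik (n_ge b k).
  have /cylinder_mkseqP/(_ i ikn) -> := lP b k.
  have := lP b' k; rewrite /c /n kb => /cylinder_mkseqP; exact.
(* Each [x d] passes through the node [rcons t d], so the limits lie in the cylinders supplied by
   the split at [t]. *)
have [_ _ _ splitH] := nextP _ (node_rich t).
apply: (splitH (l \o x)) => d; rewrite -nodeS.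
have := lP (x d) (size t).+1; rewrite /c /n.
by have := tx d; rewrite /cylinder /= size_rcons => ->.
Qed.

End dichotomy.

Theorem theorem1p1 (D : discreteTopologicalType) (X : topologicalType)
    (H : set (D -> X))
    (D_ge2 : exists d0 d1 : D, d0 <> d1)
    (X_analytic : analytic X)
    (X_hausdorff : hausdorff_space X)
    (H_dihypergraph : dihypergraph H)
    (H_box_open : box_open H) :
  let coloring := has_aleph0_coloring H in
  let continuous_hom := exists pi : sequence_space D -> X,
    continuous pi /\ homomorphism (@H_seq D) H pi in
  (coloring \/ continuous_hom) /\ ~ (coloring /\ continuous_hom).
Proof.
move=> coloring continuous_hom.
have [d0 _] := D_ge2.
have [C C_closed [f f_cont fC]] := X_analytic.
split; last first.
  by move=> [/(aleph0_coloringP d0) + [pi [_]]]; exact: coloring_no_hom.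
have [cH|ncH] := pselect (colorable_on H setT).
  by left; exact/(aleph0_coloringP d0).
by right; exact: (hom_of_not_colorable d0 C_closed f_cont).
Qed.
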